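(* Let $\mathfrak W$ be a variety of (unitary) associative $K$-algebras containing the metabelian variety $\mathfrak M$. Then for any $m\geq 2$ and for any fixed nonzero Weitzenböck derivation $\delta$, the algebra of constants $F_m({\mathfrak W})^{\delta}$ is not finitely generated.
   Context: $K$ is a field of characteristic $0$. Varieties are varieties of unitary associative $K$-algebras, i.e. classes of all such algebras satisfying a given set of polynomial identities. $\mathfrak M$ is the variety defined by the identity $[x_1,x_2][x_3,x_4]=0$, where $[a,b]=ab-ba$. For a variety $\mathfrak W$, $T(\mathfrak W)$ is the ideal of all polynomial identities of $\mathfrak W$ in the free unitary associative algebra $K\langle x_1,x_2,\ldots\rangle$, and $F_m(\mathfrak W)=K\langle x_1,\ldots,x_m\rangle/(K\langle x_1,\ldots,x_m\rangle\cap T(\mathfrak W))$ is the relatively free algebra of rank $m$. A Weitzenböck derivation $\delta$ is a nonzero triangular linear derivation, i.e. a derivation of $K\langle x_1,\ldots,x_m\rangle$ with $\delta(x_j)\in\mathrm{span}_K(x_1,\ldots,x_{j-1})$ for $j=1,\ldots,m$, not all zero; it induces a derivation, also denoted $\delta$, on $F_m(\mathfrak W)$. $F_m(\mathfrak W)^\delta$ is the kernel of $\delta$ in $F_m(\mathfrak W)$; finite generation is meant as a $K$-algebra. *)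

(* Defs.v *)
From HB Require Import structures.
Set Warnings "-notation-overridden,-ambiguous-paths,-notation-incompatible-prefix".
Set Warnings "-redundant-canonical-projection".
From mathcomp Require Import all_boot all_order all_algebra.
From mathcomp Require Import generic_quotient ring_quotient finmap boolp.
From mathcomp.multinomials Require Import monalg.

Set Implicit Arguments.
Unset Strict Implicit.
Unset Printing Implicit Defensive.

Import GRing.Theory.
Local Open Scope ring_scope.
Local Open Scope quotient_scope.

(* The free unitary associative algebra K<I>: finitely supported K-linear
   combinations of words in the letters I, multiplied by concatenation. *)
Definition freealg (K : fieldType) (I : choiceType) := {malg K[{fmonom I}]}.

Fact malg_scalerAr (K : comNzRingType) (M : monomType) (k : K)
  (f g : {malg K[M]}) : k *: (f * g) = f * (k *: g).
Proof.
apply/malgP => w; rewrite mcoeffZ mcoeffMl.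
rewrite (mcoeffMlw _ (fsubset_refl _) (msuppZ_le k g)) mulr_sumr.
apply: eq_bigr => u _; rewrite mulr_sumr; apply: eq_bigr => v _.
by rewrite mcoeffZ mulrnAr mulrCA.
Qed.

(* The operations are those of {malg K[{fmonom I}]}, locked because unification
   must not unfold them. *)
HB.lock Definition freealg_add (K : fieldType) (I : choiceType)
  (f g : {malg K[{fmonom I}]}) : {malg K[{fmonom I}]} := f + g.
HB.lock Definition freealg_opp (K : fieldType) (I : choiceType)
  (f : {malg K[{fmonom I}]}) : {malg K[{fmonom I}]} := - f.
HB.lock Definition freealg_mul (K : fieldType) (I : choiceType)
  (f g : {malg K[{fmonom I}]}) : {malg K[{fmonom I}]} := f * g.
HB.lock Definition freealg_scale (K : fieldType) (I : choiceType)
  (k : K) (f : {malg K[{fmonom I}]}) : {malg K[{fmonom I}]} := k *: f.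
HB.lock Definition fword (K : fieldType) (I : choiceType)
  (w : {fmonom I}) : freealg K I := << w >>.
Arguments fword K {I} w.

Section FreeAlgebra.
Context (K : fieldType) (I : choiceType).

Local Notation M := {malg K[{fmonom I}]}.
Local Notation addE := freealg_add.unlock.
Local Notation oppE := freealg_opp.unlock.
Local Notation mulE := freealg_mul.unlock.
Local Notation scaleE := freealg_scale.unlock.

HB.instance Definition _ := Choice.on (freealg K I).

Fact freealg_addA : associative (@freealg_add K I).
Proof. by move=> f g h; rewrite addE addrA. Qed.
Fact freealg_addC : commutative (@freealg_add K I).
Proof. by move=> f g; rewrite addE addrC. Qed.
Fact freealg_add0 : left_id (0 : M) (@freealg_add K I).
Proof. by move=> f; rewrite addE add0r. Qed.
Fact freealg_addN : left_inverse (0 : M) (@freealg_opp K I) (@freealg_add K I).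
Proof. by move=> f; rewrite addE oppE addNr. Qed.

HB.instance Definition _ := GRing.isZmodule.Build (freealg K I)
  freealg_addA freealg_addC freealg_add0 freealg_addN.

Fact freealg_mulA : associative (@freealg_mul K I).
Proof. by move=> f g h; rewrite mulE mulrA. Qed.
Fact freealg_mul1 : left_id (1 : M) (@freealg_mul K I).
Proof. by move=> f; rewrite mulE mul1r. Qed.
Fact freealg_1mul : right_id (1 : M) (@freealg_mul K I).
Proof. by move=> f; rewrite mulE mulr1. Qed.
Fact freealg_mulDl : left_distributive (@freealg_mul K I) (@freealg_add K I).
Proof. by move=> f g h; rewrite mulE addE mulrDl. Qed.
Fact freealg_mulDr : right_distributive (@freealg_mul K I) (@freealg_add K I).
Proof. by move=> f g h; rewrite mulE addE mulrDr. Qed.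

HB.instance Definition _ := GRing.Zmodule_isNzRing.Build (freealg K I)
  freealg_mulA freealg_mul1 freealg_1mul freealg_mulDl freealg_mulDr
  (oner_neq0 M).

Fact freealg_scaleA (k l : K) (f : M) :
  freealg_scale k (freealg_scale l f) = freealg_scale (k * l) f.
Proof. by rewrite scaleE scalerA. Qed.
Fact freealg_scale1 : left_id 1 (@freealg_scale K I).
Proof. by move=> f; rewrite scaleE scale1r. Qed.
Fact freealg_scaleDr : right_distributive (@freealg_scale K I) (@freealg_add K I).
Proof. by move=> k f g; rewrite scaleE addE scalerDr. Qed.
Fact freealg_scaleDl (f : M) : 
  {morph (@freealg_scale K I)^~ f : k l / k + l >-> freealg_add k l}.
Proof. by move=> k l; rewrite scaleE addE scalerDl. Qed.

HB.instance Definition _ := GRing.Zmodule_isLmodule.Build K (freealg K I)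
  freealg_scaleA freealg_scale1 freealg_scaleDr freealg_scaleDl.

Fact freealg_scaleAl (k : K) (f g : M) :
  freealg_scale k (freealg_mul f g) = freealg_mul (freealg_scale k f) g.
Proof. by rewrite mulE scaleE scalerAl. Qed.

HB.instance Definition _ :=
  GRing.Lmodule_isLalgebra.Build K (freealg K I) freealg_scaleAl.

Fact freealg_scaleAr (k : K) (f g : M) :
  freealg_scale k (freealg_mul f g) = freealg_mul f (freealg_scale k g).
Proof. by rewrite mulE scaleE malg_scalerAr. Qed.

HB.instance Definition _ :=
  GRing.Lalgebra_isAlgebra.Build K (freealg K I) freealg_scaleAr.

Lemma freealg_addE (f g : freealg K I) : f + g = (f : M) + (g : M).
Proof. by rewrite -[LHS]/(freealg_add f g) addE. Qed.

Lemma freealg_oppE (f : freealg K I) : - f = - (f : M).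
Proof. by rewrite -[LHS]/(freealg_opp f) oppE. Qed.

Lemma freealg_mulE (f g : freealg K I) : f * g = (f : M) * (g : M).
Proof. by rewrite -[LHS]/(freealg_mul f g) mulE. Qed.

Lemma freealg_scaleE (k : K) (f : freealg K I) : k *: f = k *: (f : M).
Proof. by rewrite -[LHS]/(freealg_scale k f) scaleE. Qed.

Definition fvar (i : I) : freealg K I := fword K (fmu i).

Lemma freealg_ind (P : freealg K I -> Prop) :
    P 1 -> (forall i f, P f -> P (fvar i * f)) ->
    (forall k f g, P f -> P g -> P (k *: f + g)) ->
  forall f, P f.
Proof.
move=> P1 PX PL f.
have P0 : P 0 by rewrite -(subrr 1) addrC -scaleN1r; apply: PL.
have PD g h : P g -> P h -> P (g + h) by move=> /PL/[apply]/(_ 1); rewrite scale1r.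
have Pw (w : {fmonom I}) : P (fword K w).
  rewrite -(fmK w); elim: (fmonom_val w) => [|i s IHs].
    by rewrite fword.unlock -fmoneE.
  have -> : fword K (FMonom (i :: s)) = fvar i * fword K (FMonom s).
    rewrite /fvar fword.unlock freealg_mulE [RHS](fgmulUU 1 1) mulr1; congr mkmalgU.
    by apply/eqP; rewrite fmP fmM fmU.
  exact: PX.
suff PM (r : seq {fmonom I}) : P (\sum_(w <- r) << f@_w *g w >>%R : M).
  by rewrite [f]monalgE; apply: PM.
elim: r => [|w r IHr]; first by rewrite big_nil.
rewrite big_cons -freealg_addE; apply: PD => //.
have Ew : << f@_w *g w >>%R = f@_w *: fword K w.
  by rewrite fword.unlock freealg_scaleE; apply/malgP => u; rewrite mcoeffZ !mcoeffU mulrnAr mulr1.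
by have := PL f@_w _ _ (Pw w) P0; rewrite addr0 -Ew.
Qed.

End FreeAlgebra.

Definition word_eval (K : fieldType) (I : choiceType) (A : algType K)
  (v : I -> A) (w : {fmonom I}) : A := \prod_(i <- w) v i.

HB.lock Definition feval (K : fieldType) (I : choiceType) (A : algType K)
  (v : I -> A) (f : freealg K I) : A := mmap (in_alg A) (word_eval v) f.
Arguments feval {K I A} v f.

Section Evaluation.
Context (K : fieldType) (I : choiceType) (A : algType K) (v : I -> A).

Fact word_eval_morphism : mmorphism (word_eval v).
Proof.
split=> [w1 w2|]; rewrite /word_eval.
  by rewrite fmM big_cat.
by rewrite fm1 big_nil.
Qed.

HB.instance Definition _ :=
  isMultiplicative.Build {fmonom I} A (word_eval v) word_eval_morphism.

Fact feval_zmod : zmod_morphism (feval v).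
Proof.
by move=> f g; rewrite feval.unlock freealg_addE freealg_oppE raddfB.
Qed.

HB.instance Definition _ :=
  GRing.isZmodMorphism.Build (freealg K I) A (feval v) feval_zmod.

Fact feval_monoid : monoid_morphism (feval v).
Proof.
have cA (f : {malg K[{fmonom I}]}) (w w' : {fmonom I}) :
    GRing.comm (in_alg A f@_w) (word_eval v w').
  by rewrite /GRing.comm /= mulr_algl mulr_algr.
have [f1 fM] := commr_mmap_is_multiplicative cA.
by split=> [|f g]; rewrite feval.unlock ?freealg_mulE; [exact: fM | exact: f1].
Qed.

HB.instance Definition _ :=
  GRing.isMonoidMorphism.Build (freealg K I) A (feval v) feval_monoid.

Fact feval_scalable : scalable (feval v).
Proof. by move=> k f; rewrite feval.unlock freealg_scaleE mmapZ /= mulr_algl. Qed.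

HB.instance Definition _ :=
  GRing.isScalable.Build K (freealg K I) A *:%R (feval v) feval_scalable.

Lemma feval_var i : feval v (fvar K i) = v i.
Proof.
by rewrite /fvar fword.unlock feval.unlock mmapU /= scale1r mul1r /word_eval fmU big_seq1.
Qed.

End Evaluation.

Lemma feval_comp (K : fieldType) (I J : choiceType) (A : algType K)
    (v : J -> A) (g : I -> freealg K J) (f : freealg K I) :
  feval v (feval g f) = feval (fun i => feval v (g i)) f.
Proof.
elim/freealg_ind: f => [|i f IHf|k f h IHf IHh].
- by rewrite !rmorph1.
- by rewrite !rmorphM /= !feval_var IHf.
- by rewrite !linearP /= IHf IHh.
Qed.

Definition bracket (R : pzRingType) (a b : R) : R := a * b - b * a.

(* Polynomial identities live in K<x_0, x_1, ...>, so variables are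
   numbered from 0. *)
Definition satisfies (K : fieldType) (A : algType K) (f : freealg K nat) : Prop :=
  forall v : nat -> A, feval v f = 0.

(* Objects of algType are nonzero algebras.  The zero algebra satisfies every
   polynomial, so leaving it out changes neither the identities of a variety nor
   the inclusions between varieties; the only variety that is lost is {0}. *)
Record variety (K : fieldType) := Variety {
  in_variety :> algType K -> Prop;
  variety_identities : exists S : freealg K nat -> Prop,
    forall A, in_variety A <-> forall f, S f -> satisfies A f;
  variety_nontrivial : exists A, in_variety A }.

Definition variety_sub (K : fieldType) (V W : variety K) : Prop :=
  forall A : algType K, V A -> W A.

Section Metabelian.
Context (K : fieldType).

Definition metabelian_poly : freealg K nat :=
  bracket (fvar K 0%N) (fvar K 1%N) * bracket (fvar K 2%N) (fvar K 3%N).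

Fact metabelian_identities : exists S : freealg K nat -> Prop,
  forall A : algType K,
    satisfies A metabelian_poly <-> forall f, S f -> satisfies A f.
Proof.
exists (fun f => f = metabelian_poly) => A; split=> [H f -> //|H].
exact: H.
Qed.

Fact metabelian_commutative (A : comAlgType K) : satisfies A metabelian_poly.
Proof.
move=> v; rewrite rmorphM rmorphB !rmorphM /=.
by rewrite [X in (X - _) * _]mulrC subrr mul0r.
Qed.

Fact metabelian_nontrivial : exists A : algType K, satisfies A metabelian_poly.
Proof. by exists K^o; apply: metabelian_commutative. Qed.

Definition metabelian : variety K :=
  Variety metabelian_identities metabelian_nontrivial.

End Metabelian.


Section RelativelyFree.
Context (K : fieldType) (W : variety K) (m : nat).

Definition T_ideal : {pred freealg K nat} :=
  fun f => `[< forall A : algType K, W A -> satisfies A f >].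

Definition finclude : freealg K 'I_m -> freealg K nat :=
  feval (fun i : 'I_m => fvar K (val i)).

(* The intersection of K<x_0, ..., x_(m-1)> with T(W). *)
Definition T_ideal_fin : {pred freealg K 'I_m} :=
  fun f => finclude f \in T_ideal.

Lemma T_idealP f :
  reflect (forall A : algType K, W A -> satisfies A f) (f \in T_ideal).
Proof. exact: asboolP. Qed.

Lemma T_ideal_finP f :
  reflect (forall A : algType K, W A -> forall v : 'I_m -> A, feval v f = 0)
          (f \in T_ideal_fin).
Proof.
apply: (iffP (T_idealP _)) => [H A WA v|H A WA v].
  pose v' (i : nat) : A := if insub i is Some j then v j else 0.
  have := H A WA v'; rewrite /finclude feval_comp => <-.
  congr feval; apply: funext => i; rewrite feval_var /v' insubT //= => lt_im.
  by congr v; apply: val_inj.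
by rewrite /finclude feval_comp; apply: H.
Qed.

Fact T_ideal_fin_zmod : zmod_closed T_ideal_fin.
Proof.
split=> [|f g /T_ideal_finP Tf /T_ideal_finP Tg]; apply/T_ideal_finP => A WA v.
  exact: raddf0.
by rewrite raddfB /= Tf // Tg // subrr.
Qed.

HB.instance Definition _ :=
  GRing.isZmodClosed.Build (freealg K 'I_m) T_ideal_fin T_ideal_fin_zmod.

Fact T_ideal_finMl f g : g \in T_ideal_fin -> f * g \in T_ideal_fin.
Proof.
move=> /T_ideal_finP Tg; apply/T_ideal_finP => A WA v.
by rewrite rmorphM /= Tg // mulr0.
Qed.

Fact T_ideal_finMr f g : f \in T_ideal_fin -> f * g \in T_ideal_fin.
Proof.
move=> /T_ideal_finP Tf; apply/T_ideal_finP => A WA v.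
by rewrite rmorphM /= Tf // mul0r.
Qed.

Fact T_ideal_finZ k f : f \in T_ideal_fin -> k *: f \in T_ideal_fin.
Proof.
move=> /T_ideal_finP Tf; apply/T_ideal_finP => A WA v.
by rewrite linearZ /= Tf // scaler0.
Qed.

Fact T_ideal_fin1 : 1 \notin T_ideal_fin.
Proof.
apply/negP => /T_ideal_finP T1; have [A WA] := variety_nontrivial W.
by have /eqP := T1 A WA (fun=> 0); rewrite rmorph1 oner_eq0.
Qed.

(* The relatively free algebra F_m(W). *)
Definition relfree := {ideal_quot T_ideal_fin}.

HB.instance Definition _ := Choice.on relfree.
HB.instance Definition _ := GRing.Zmodule.on relfree.
HB.instance Definition _ := EqQuotient.on relfree.

Definition relfree_proj (f : freealg K 'I_m) : relfree := \pi_relfree f.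

Lemma relfree_projP f g :
  reflect (relfree_proj f = relfree_proj g) (f - g \in T_ideal_fin).
Proof. by rewrite Quotient.idealrBE; apply: eqP. Qed.

Lemma relfree_reprK u : relfree_proj (repr u) = u.
Proof. exact: reprK. Qed.

Fact relfree_proj_zmod : zmod_morphism relfree_proj.
Proof. by move=> f g; rewrite /relfree_proj !piE. Qed.

HB.instance Definition _ := GRing.isZmodMorphism.Build (freealg K 'I_m) relfree
  relfree_proj relfree_proj_zmod.

End RelativelyFree.
Arguments T_ideal_fin {K} W m f.

HB.lock Definition relfree_mul (K : fieldType) (W : variety K) (m : nat)
  (u v : relfree W m) : relfree W m := relfree_proj W (repr u * repr v).
HB.lock Definition relfree_scale (K : fieldType) (W : variety K) (m : nat)
  (k : K) (u : relfree W m) : relfree W m := relfree_proj W (k *: repr u).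
Arguments relfree_mul {K W m} u v.
Arguments relfree_scale {K W m} k u.

Section RelativelyFreeAlgebra.
Context (K : fieldType) (W : variety K) (m : nat).

Local Notation F := (relfree W m).
Local Notation proj := (@relfree_proj K W m).

Fact relfree_projM f g : proj (f * g) = relfree_mul (proj f) (proj g).
Proof.
rewrite relfree_mul.unlock; apply/relfree_projP.
set f' := repr _; set g' := repr _.
rewrite (_ : f * g - f' * g' = (f - f') * g + f' * (g - g')); last first.
  by rewrite mulrBl mulrBr addrA subrK.
apply: rpredD; [apply: T_ideal_finMr | apply: T_ideal_finMl];
  by apply/relfree_projP; rewrite relfree_reprK.
Qed.

Fact relfree_projZ k f : proj (k *: f) = relfree_scale k (proj f).
Proof.
rewrite relfree_scale.unlock; apply/relfree_projP; rewrite -scalerBr.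
by apply: T_ideal_finZ; apply/relfree_projP; rewrite relfree_reprK.
Qed.

Fact relfree_ind (P : F -> Prop) : (forall f, P (proj f)) -> forall u, P u.
Proof. by move=> Pp u; rewrite -[u]relfree_reprK. Qed.

Fact relfree_mulA : associative (@relfree_mul K W m).
Proof.
elim/relfree_ind=> f; elim/relfree_ind=> g; elim/relfree_ind=> h.
by rewrite -!relfree_projM mulrA.
Qed.

Fact relfree_mul1 : left_id (proj 1) relfree_mul.
Proof. by elim/relfree_ind=> f; rewrite -relfree_projM mul1r. Qed.

Fact relfree_1mul : right_id (proj 1) relfree_mul.
Proof. by elim/relfree_ind=> f; rewrite -relfree_projM mulr1. Qed.

Fact relfree_mulDl : left_distributive (@relfree_mul K W m) +%R.
Proof.
elim/relfree_ind=> f; elim/relfree_ind=> g; elim/relfree_ind=> h.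
by rewrite -raddfD -!relfree_projM -raddfD mulrDl.
Qed.

Fact relfree_mulDr : right_distributive (@relfree_mul K W m) +%R.
Proof.
elim/relfree_ind=> f; elim/relfree_ind=> g; elim/relfree_ind=> h.
by rewrite -raddfD -!relfree_projM -raddfD mulrDr.
Qed.

Fact relfree_1neq0 : proj 1 != 0.
Proof.
apply: contra (@T_ideal_fin1 K W m) => /eqP p1.
by rewrite -[X in X \in _]subr0; apply/relfree_projP; rewrite raddf0.
Qed.

HB.instance Definition _ := GRing.Zmodule_isNzRing.Build F
  relfree_mulA relfree_mul1 relfree_1mul relfree_mulDl relfree_mulDr
  relfree_1neq0.

Fact relfree_scaleA (k l : K) (u : F) :
  relfree_scale k (relfree_scale l u) = relfree_scale (k * l) u.
Proof.
by elim/relfree_ind: u => f; rewrite -!relfree_projZ scalerA.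
Qed.

Fact relfree_scale1 : left_id 1 (@relfree_scale K W m).
Proof. by elim/relfree_ind=> f; rewrite -relfree_projZ scale1r. Qed.

Fact relfree_scaleDr : right_distributive (@relfree_scale K W m) +%R.
Proof.
move=> k; elim/relfree_ind=> f; elim/relfree_ind=> g.
by rewrite -raddfD -!relfree_projZ -raddfD scalerDr.
Qed.

Fact relfree_scaleDl (u : F) : {morph relfree_scale^~ u : k l / k + l}.
Proof.
by elim/relfree_ind: u => f k l; rewrite -!relfree_projZ -raddfD scalerDl.
Qed.

HB.instance Definition _ := GRing.Zmodule_isLmodule.Build K F
  relfree_scaleA relfree_scale1 relfree_scaleDr relfree_scaleDl.

Fact relfree_scaleAl (k : K) (u v : F) : k *: (u * v) = (k *: u) * v.
Proof.
elim/relfree_ind: u => f; elim/relfree_ind: v => g.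
rewrite /GRing.scale /GRing.mul /=.
by rewrite -relfree_projZ -!relfree_projM -relfree_projZ scalerAl.
Qed.

HB.instance Definition _ :=
  GRing.Lmodule_isLalgebra.Build K F relfree_scaleAl.

Fact relfree_scaleAr (k : K) (u v : F) : k *: (u * v) = u * (k *: v).
Proof.
elim/relfree_ind: u => f; elim/relfree_ind: v => g.
rewrite /GRing.scale /GRing.mul /=.
by rewrite -relfree_projZ -!relfree_projM -relfree_projZ scalerAr.
Qed.

HB.instance Definition _ :=
  GRing.Lalgebra_isAlgebra.Build K F relfree_scaleAr.

Fact relfree_proj_monoid : monoid_morphism proj.
Proof. by split=> // f g; apply: relfree_projM. Qed.

HB.instance Definition _ := GRing.isMonoidMorphism.Build (freealg K 'I_m) F
  proj relfree_proj_monoid.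

Fact relfree_proj_scalable : scalable proj.
Proof. by move=> k f; apply: relfree_projZ. Qed.

HB.instance Definition _ := GRing.isScalable.Build K (freealg K 'I_m) F *:%R
  proj relfree_proj_scalable.

End RelativelyFreeAlgebra.

Definition derivation (K : fieldType) (A : algType K) (d : A -> A) : Prop :=
  linear d /\ forall a b, d (a * b) = d a * b + a * d b.

(* A derivation d of K<x_0, ..., x_(m-1)> acts on F_m(W) through representatives;
   in characteristic 0 the result does not depend on their choice, see
   induced_proj below. *)
Definition induced (K : fieldType) (W : variety K) (m : nat)
    (d : freealg K 'I_m -> freealg K 'I_m) (u : relfree W m) : relfree W m :=
  relfree_proj W (d (repr u)).

Lemma derivation0 (K : fieldType) (A : algType K) (d : A -> A) :
  derivation d -> d 0 = 0.
Proof.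
by move=> [dL _]; have := dL (-1) 0 0; rewrite !scaleN1r !addNr.
Qed.

Lemma derivation1 (K : fieldType) (A : algType K) (d : A -> A) :
  derivation d -> d 1 = 0.
Proof.
move=> [_ /(_ 1 1)]; rewrite !mulr1 mul1r => /eqP.
by rewrite -subr_eq0 opprD addrA subrr add0r oppr_eq0 => /eqP.
Qed.

Section InducedDerivation.
Context (K : fieldType) (charK : [pchar K] =i pred0).

Lemma vanishing_coef1 (A : algType K) (p : {poly A}) :
  (forall k : K, p.[k%:A] = 0) -> p`_1 = 0.
Proof.
move=> p0; have [|lt1p] := leqP (size p) 1; first exact: nth_default.
pose n := size p; pose V := Vandermonde n (\row_(j < n) (j%:R : K)).
have V_unit : V \in unitmx.
  rewrite unitmxE det_Vandermonde unitfE; apply/prodf_neq0 => i _.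
  apply/prodf_neq0 => j lt_ij; rewrite !mxE -natrB ?(ltnW lt_ij) //.
  by rewrite (pcharf0P K).1 // subn_eq0 -ltnNge.
pose i1 : 'I_n := Ordinal lt1p.
pose u : 'cV_n := invmx V *m delta_mx i1 0.
have Vu : V *m u = delta_mx i1 0 by rewrite mulmxA mulmxV ?mul1mx.
have -> : p`_1 = \sum_(i < n) p`_i * ((V *m u) i 0)%:A.
  rewrite Vu (bigD1 i1) //= big1 => [|i i_neq1].
    by rewrite mxE !eqxx scale1r mulr1 addr0.
  by rewrite mxE (negbTE i_neq1) scale0r mulr0.
have -> : \sum_(i < n) p`_i * ((V *m u) i 0)%:A
    = \sum_(j < n) u j 0 *: p.[(j%:R : K)%:A].
  under eq_bigr do rewrite mxE scaler_suml mulr_sumr.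
  rewrite exchange_big; apply: eq_bigr => j _ /=.
  rewrite horner_coef scaler_sumr; apply: eq_bigr => i _.
  by rewrite !mxE exprZn expr1n -!scalerAr !mulr1 scalerA mulrC.
by rewrite big1 // => j _; rewrite p0 scaler0.
Qed.

Lemma feval_line (I : choiceType) (A : algType K) (v : I -> A)
    (d : freealg K I -> freealg K I) (f : freealg K I) : derivation d ->
  exists p : {poly A},
    [/\ forall k, feval (fun i => v i + k *: feval v (d (fvar K i))) f = p.[k%:A],
        p`_0 = feval v f & p`_1 = feval v (d f)].
Proof.
move=> dD; have [dL dM] := dD.
have algC (p : {poly A}) (k : K) : comm_poly p k%:A.
  by rewrite /comm_poly mulr_algl mulr_algr.
elim/freealg_ind: f => [|i f [p [pE p0 p1]]|k f g [p [pE p0 p1]] [q [qE q0 q1]]].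
- exists 1; split=> [k||]; first by rewrite rmorph1 hornerC.
    by rewrite coef1 (rmorph1 (feval v)).
  by rewrite coef1 (derivation1 dD) (raddf0 (feval v)).
- set w := feval v (d (fvar K i)).
  exists (((v i)%:P + w%:P * 'X) * p); split=> [k||].
  + rewrite rmorphM /= feval_var pE hornerM_comm // hornerD hornerC hornerMX.
    by rewrite hornerC mulr_algr.
  + by rewrite mulrDl -mulrA coefD !coefCM coefXM mulr0 addr0 p0 rmorphM /= feval_var.
  + rewrite mulrDl -mulrA coefD !coefCM coefXM /= p0 p1 dM rmorphD !rmorphM /=.
    by rewrite feval_var addrC.
- exists (k%:A%:P * p + q); split=> [l||].
  + by rewrite linearP /= pE qE hornerD hornerM_comm // hornerC mulr_algl.
  + by rewrite coefD coefCM p0 q0 mulr_algl linearP.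
  + by rewrite coefD coefCM p1 q1 mulr_algl dL linearP.
Qed.

Context (W : variety K) (m : nat) (d : freealg K 'I_m -> freealg K 'I_m).
Hypothesis dD : derivation d.

Lemma derivation_T_ideal f : f \in T_ideal_fin W m -> d f \in T_ideal_fin W m.
Proof.
move=> /T_ideal_finP Tf; apply/T_ideal_finP => A WA v.
have [p [pE _ <-]] := feval_line v f dD.
by apply: vanishing_coef1 => k; rewrite -pE Tf.
Qed.

Lemma induced_proj f : induced d (relfree_proj W f) = relfree_proj W (d f).
Proof.
have [dL _] := dD.
apply/relfree_projP; rewrite -[_ - _]addrC -scaleN1r -dL scaleN1r addrC.
by apply: derivation_T_ideal; apply/relfree_projP; rewrite relfree_reprK.
Qed.

Lemma induced_derivation : derivation (@induced K W m d).
Proof.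
have [dL dM] := dD; split=> [k|].
  elim/relfree_ind=> f; elim/relfree_ind=> g.
  by rewrite -linearP !induced_proj dL linearP.
elim/relfree_ind=> f; elim/relfree_ind=> g.
by rewrite -rmorphM !induced_proj dM rmorphD !rmorphM.
Qed.

End InducedDerivation.

(* Triangular with respect to the given order of the variables. *)
Definition weitzenbock (K : fieldType) (m : nat)
    (d : freealg K 'I_m -> freealg K 'I_m) : Prop :=
  [/\ derivation d,
      forall j : 'I_m, exists c : 'I_m -> K,
        d (fvar K j) = \sum_(i < m | (i < j)%N) c i *: fvar K i
    & exists j : 'I_m, d (fvar K j) != 0].

Definition constants (K : fieldType) (W : variety K) (m : nat)
    (d : freealg K 'I_m -> freealg K 'I_m) : {pred relfree W m} :=
  [pred u | induced d u == 0].
Arguments constants {K} W {m} d.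

Lemma constants_subalg (K : fieldType) (charK : [pchar K] =i pred0)
    (W : variety K) (m : nat) (d : freealg K 'I_m -> freealg K 'I_m) :
  derivation d -> GRing.subalg_closed (constants W d).
Proof.
move=> /(induced_derivation charK W) iD; have [iL iM] := iD.
split=> [|k u v /eqP u0 /eqP v0|u v /eqP u0 /eqP v0]; apply/eqP.
- exact: derivation1.
- by rewrite iL u0 v0 scaler0 addr0.
- by rewrite iM u0 v0 mul0r mulr0 addr0.
Qed.

Definition generated_by (K : fieldType) (A : algType K) (s : seq A) (u : A) : Prop :=
  forall B : {pred A}, GRing.subalg_closed B -> {subset s <= B} -> u \in B.

Definition finitely_generated (K : fieldType) (A : algType K) (S : {pred A}) : Prop :=
  exists s : seq A, forall u, u \in S <-> generated_by s u.

(* Main.v *)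
Require Import Defs.
From HB Require Import structures.
From mathcomp Require Import all_boot all_order all_algebra.

(** Why constants are not finitely generated.  Let x_j be the first variable
    that the derivation does not kill, and put b = x_j and a = d b, so that
    d a = 0.  The operator f |-> a f b - b f a commutes with d, because the two
    extra terms a f a cancel; hence all its iterates on [a, b] are constants,
    already in the free algebra ([derivation_iter_skew]).

    To see that finitely many constants cannot generate all of these, the free
    algebra is evaluated in the upper triangular 2 x 2 matrices over K[t], which
    are metabelian and so belong to W.  The upper diagonal entry is evaluation
    at a point y of K^m, and the lower one is evaluation along an integral curve
    z of the vector field on K^m which is the linear derivation d.  Along such a
    curve d becomes d/dt ([feval_integral_curve]), so, in characteristic 0,
    every constant has both diagonal entries in K.  Among such matrices the
    upper right entries are only ever multiplied by scalars: a bound on their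
    degrees in finitely many constants is a bound on the whole algebra that
    these generate ([bounded_subalg]).  But y and z can be chosen with
    y(a) = z(a) = 1, y(b) = 0 and z(b) of degree one, and then the upper right
    entry of the k-th iterate on [a, b] is the power z(b)^(k+1)
    ([iter_skew_triangular]), of unbounded degree. *)

Set Implicit Arguments.
Unset Strict Implicit.
Unset Printing Implicit Defensive.

Import GRing.Theory.
Local Open Scope ring_scope.

(** * Triangular matrices *)

(** The triple (p, q, r) stands for the matrix with rows (p, q) and (0, r). *)
Definition triangular (K : fieldType) (R : comAlgType K) : Type := R * R * R.

Section Triangular.
Context (K : fieldType) (R : comAlgType K).
Local Notation T := (triangular R).
Implicit Types u v w : T.

HB.instance Definition _ := GRing.Lmodule.on T.

Definition triangular_mul u v : T :=
  (u.1.1 * v.1.1, u.1.1 * v.1.2 + u.1.2 * v.2, u.2 * v.2).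
Definition triangular_one : T := (1, 0, 1).

Lemma triangularP u v :
  u.1.1 = v.1.1 -> u.1.2 = v.1.2 -> u.2 = v.2 -> u = v.
Proof. by case: u v => [[? ?] ?] [[? ?] ?] /= -> -> ->. Qed.

Fact triangular_mulA : associative triangular_mul.
Proof.
move=> u v w; apply: triangularP; rewrite /= ?mulrA //.
by rewrite mulrDr mulrDl !mulrA addrA.
Qed.
Fact triangular_mul1 : left_id triangular_one triangular_mul.
Proof. by move=> u; apply: triangularP; rewrite /= ?mul1r ?mul0r ?addr0. Qed.
Fact triangular_1mul : right_id triangular_one triangular_mul.
Proof. by move=> u; apply: triangularP; rewrite /= ?mulr1 ?mulr0 ?add0r. Qed.
Fact triangular_mulDl : left_distributive triangular_mul +%R.
Proof. by move=> u v w; apply: triangularP; rewrite /= !mulrDl // addrACA. Qed.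
Fact triangular_mulDr : right_distributive triangular_mul +%R.
Proof. by move=> u v w; apply: triangularP; rewrite /= !mulrDr // addrACA. Qed.
Fact triangular_1neq0 : triangular_one != 0 :> T.
Proof. by apply/eqP => /(congr1 snd) /eqP; rewrite oner_eq0. Qed.

HB.instance Definition _ := GRing.Zmodule_isNzRing.Build T
  triangular_mulA triangular_mul1 triangular_1mul
  triangular_mulDl triangular_mulDr triangular_1neq0.

Fact triangular_scaleAl (k : K) u v :
  k *: (triangular_mul u v) = triangular_mul (k *: u) v.
Proof. by apply: triangularP; rewrite /= ?scalerDr !scalerAl. Qed.

HB.instance Definition _ :=
  GRing.Lmodule_isLalgebra.Build K T triangular_scaleAl.

Fact triangular_scaleAr (k : K) u v :
  k *: (triangular_mul u v) = triangular_mul u (k *: v).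
Proof. by apply: triangularP; rewrite /= ?scalerDr !scalerAr. Qed.

HB.instance Definition _ :=
  GRing.Lalgebra_isAlgebra.Build K T triangular_scaleAr.

Lemma bracket_triangular u v : bracket u v =
  (0, (u.1.1 - u.2) * v.1.2 - (v.1.1 - v.2) * u.1.2, 0).
Proof.
apply: triangularP => /=.
- by rewrite [v.1.1 * _]mulrC subrr.
- rewrite !mulrBl [u.1.2 * _]mulrC [v.1.2 * _]mulrC !opprD !opprK addrACA -addrA.
  rewrite -[RHS]addrA; congr (_ + _).
  by rewrite addrCA [RHS]addrCA addrCA; congr (_ + _); rewrite addrC.
- by rewrite [v.2 * _]mulrC subrr.
Qed.

(** Commutators have zero diagonal, and two such matrices have product 0. *)
Lemma triangular_metabelian : metabelian K T.
Proof.
move=> v; rewrite rmorphM !rmorphB !rmorphM /= !feval_var.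
rewrite -!/(bracket _ _) !bracket_triangular.
by apply: triangularP; rewrite /= ?mul0r ?mulr0 ?addr0.
Qed.

Lemma feval_triangular (I : choiceType) (w : I -> T) f :
  (feval w f).1.1 = feval (fun i => (w i).1.1) f
  /\ (feval w f).2 = feval (fun i => (w i).2) f.
Proof.
elim/freealg_ind: f => [|i f [IH1 IH2]|k f g [IHf1 IHf2] [IHg1 IHg2]].
- by rewrite !rmorph1.
- by rewrite !rmorphM /= !feval_var IH1 IH2.
- by rewrite !linearP /= IHf1 IHf2 IHg1 IHg2.
Qed.

End Triangular.

(** * Constants built from two elements *)

Definition skew (A : pzRingType) (a b f : A) : A := a * f * b - b * f * a.

(** Both d [a, b] = [a, a] and the defect d (skew a b f) - skew a b (d f)
    = a f a - a f a vanish. *)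
Lemma derivation_iter_skew (K : fieldType) (A : algType K) (d : A -> A) a b k :
  derivation d -> d a = 0 -> d b = a -> d (iter k (skew a b) (bracket a b)) = 0.
Proof.
move=> [dL dM] da db.
have dB f g : d (f - g) = d f - d g.
  by rewrite addrC -scaleN1r dL scaleN1r addrC.
elim: k => [|k IHk] /=.
  by rewrite dB !dM da db !(mul0r, mulr0) add0r addr0 subrr.
by rewrite dB !dM IHk da db !(mul0r, mulr0, add0r, addr0) subrr.
Qed.

Lemma rmorph_iter_skew (A B : pzRingType) (h : {rmorphism A -> B}) a b k :
  h (iter k (skew a b) (bracket a b))
  = iter k (skew (h a) (h b)) (bracket (h a) (h b)).
Proof.
elim: k => [|k IHk] /=; first by rewrite rmorphB !rmorphM.
by rewrite rmorphB !rmorphM /= IHk.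
Qed.

(** On matrices with zero diagonal, skew a b multiplies the upper right entry by
    a_11 b_22 - b_11 a_22, which is p here; this is why b_11 is not b_22. *)
Lemma iter_skew_triangular (K : fieldType) (R : comAlgType K) (p : R) k :
  let a : triangular R := (1, 1, 1) in let b : triangular R := (0, 0, p) in
  iter k (skew a b) (bracket a b) = (0, p ^+ k.+1, 0).
Proof.
move=> a b; elim: k => [|k IHk] /=.
  by rewrite bracket_triangular /= mulr0 !sub0r mulr1 opprK.
rewrite IHk; apply: triangularP => /=.
- by rewrite !(mulr0, mul0r) subrr.
- by rewrite !(mulr0, mul0r, mul1r, add0r, addr0) subr0 -exprSr.
- by rewrite !(mulr0, mul0r) subrr.
Qed.

(** * Evaluation along an integral curve *)

Lemma feval_closed (K : fieldType) (I : choiceType) (A : algType K)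
    (B : {pred A}) (v : I -> A) f :
  GRing.subalg_closed B -> (forall i, v i \in B) -> feval v f \in B.
Proof.
move=> [B1 BL BM] Bv; elim/freealg_ind: f => [|i f IHf|k f g IHf IHg].
- by rewrite rmorph1.
- by rewrite rmorphM /= feval_var BM.
- by rewrite linearP BL.
Qed.

Lemma size_le_subalg (K : fieldType) :
  GRing.subalg_closed [pred p : {poly K} | (size p <= 1)%N].
Proof.
split=> [|k p q|p q]; rewrite !inE; first by rewrite size_poly1.
  move=> sp sq; apply: leq_trans (size_polyD _ _) _.
  by rewrite geq_max sq (leq_trans (size_scale_leq _ _)).
by move=> /size1_polyC-> /size1_polyC->; rewrite -polyCM size_polyC leq_b1.
Qed.

Section IntegralCurve.
Context (K : fieldType) (charK : [pchar K] =i pred0).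

Lemma natr_neq0 n : n.+1%:R != 0 :> K.
Proof. by rewrite (pcharf0P K).1. Qed.

Lemma deriv_eq0 (p : {poly K}) : p^`() = 0 -> p = (p`_0)%:P.
Proof.
move=> p'0; apply/polyP => -[|i]; rewrite coefC //=.
have := congr1 (fun q : {poly K} => q`_i) p'0.
rewrite coef_deriv coef0 -mulr_natr => /eqP.
by rewrite mulf_eq0 (negPf (natr_neq0 i)) orbF => /eqP.
Qed.

Lemma antiderivative (p : {poly K}) c : exists q, q^`() = p /\ q`_0 = c.
Proof.
pose E i := if i is j.+1 then p`_j / j.+1%:R else c.
exists (\poly_(i < (size p).+1) E i); split; last by rewrite coef_poly.
apply/polyP => i; rewrite coef_deriv coef_poly ltnS.
case: ltnP => [_|le_pi]; first by rewrite /= -[LHS]mulr_natr divfK ?natr_neq0.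
by rewrite mul0rn nth_default.
Qed.

(** A triangular linear system of differential equations is solved by
    successive integration, so it has polynomial solutions. *)
Lemma integral_curve_exists m (c : 'I_m -> 'I_m -> K) (v : 'I_m -> K) :
  exists z : 'I_m -> {poly K}, forall i : 'I_m,
    (z i)^`() = \sum_(l < m | (l < i)%N) c i l *: z l /\ (z i)`_0 = v i.
Proof.
suff zn n : exists z : 'I_m -> {poly K}, forall i : 'I_m, (i < n)%N ->
    (z i)^`() = \sum_(l < m | (l < i)%N) c i l *: z l /\ (z i)`_0 = v i.
  by have [z zP] := zn m; exists z => i; apply: zP.
elim: n => [|n [z zP]]; first by exists (fun=> 0).
have [lt_nm|le_mn] := ltnP n m; last first.
  by exists z => i _; apply: zP; apply: leq_trans le_mn.
pose n' := Ordinal lt_nm.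
have [q [q' q0]] := antiderivative (\sum_(l < m | (l < n)%N) c n' l *: z l) (v n').
exists (fun i => if i == n' then q else z i) => i lt_in.
have -> : \sum_(l < m | (l < i)%N) c i l *: (if l == n' then q else z l)
        = \sum_(l < m | (l < i)%N) c i l *: z l.
  apply: eq_bigr => l lt_li; case: eqP => // El.
  by move: lt_li; rewrite El /= ltnNge -ltnS lt_in.
case: eqP => [->//|/eqP ne_in]; apply: zP.
by rewrite ltn_neqAle -ltnS lt_in andbT.
Qed.

(** The chain rule.  In characteristic 0 it makes every constant of d, in
    particular modulo the identities of commutative algebras, constant along the
    curve. *)
Lemma feval_integral_curve (I : choiceType) (z : I -> {poly K})
    (d : freealg K I -> freealg K I) f : derivation d ->
    (forall i, (z i)^`() = feval z (d (fvar K i))) ->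
  (feval z f)^`() = feval z (d f).
Proof.
move=> dD z'; have [dL dM] := dD.
elim/freealg_ind: f => [|i f IHf|k f g IHf IHg].
- by rewrite (derivation1 dD) rmorph1 rmorph0 derivC.
- by rewrite dM rmorphD !rmorphM /= !feval_var derivM z' IHf.
- by rewrite dL !linearP /= IHf IHg.
Qed.

End IntegralCurve.

(** * Bounded subalgebras *)

Definition bounded (K : fieldType) n (u : triangular {poly K}) : bool :=
  [&& (size u.1.1 <= 1)%N, (size u.1.2 <= n)%N & (size u.2 <= 1)%N].

(** The upper right entry of u v is u_11 v_12 + u_12 v_22, a combination of v_12
    and u_12 with coefficients in K, so multiplication does not raise n. *)
Lemma bounded_subalg (K : fieldType) n :
  GRing.subalg_closed (@bounded K n : {pred triangular {poly K}}).
Proof.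
have [s1 sL sM] := size_le_subalg K.
have sizeD (p q : {poly K}) :
    (size p <= n -> size q <= n -> size (p + q)%R <= n)%N.
  by move=> sp sq; apply: leq_trans (size_polyD _ _) _; rewrite geq_max sp sq.
split=> [|k u v|u v]; rewrite !unfold_in /bounded /=.
- by rewrite size_poly1 size_poly0.
- move=> /and3P[u1 u2 u3] /and3P[v1 v2 v3]; apply/and3P; split.
  + exact: sL.
  + by apply: sizeD v2; apply: leq_trans (size_scale_leq _ _) u2.
  + exact: sL.
- move=> /and3P[u1 u2 u3] /and3P[v1 v2 v3]; apply/and3P; split.
  + exact: sM.
  + rewrite (size1_polyC u1) (size1_polyC v3) mul_polyC [u.1.2 * _]mulrC mul_polyC.
    by apply: sizeD; apply: leq_trans (size_scale_leq _ _) _.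
  + exact: sM.
Qed.

(** * Iterates of unbounded degree *)

Theorem theorem6p4 (K : fieldType) (charK : [pchar K]%R =i pred0)
  (W : variety K) (hMW : variety_sub (metabelian K) W)
  (m : nat) (hm : (2 <= m)%N)
  (d : freealg K 'I_m -> freealg K 'I_m) (hd : weitzenbock d) :
  ~ finitely_generated (constants W d).
Proof.
case: hd => dD /fin_all_exists[c dx] [j1 dj1] [s sP].
case: (@arg_minnP _ j1 (fun j => d (fvar K j) != 0) val dj1) => j dj j_min.
have d0 (i : 'I_m) : (i < j)%N -> d (fvar K i) = 0.
  by move=> lt_ij; apply: contraTeq lt_ij => /j_min; rewrite -leqNgt.
have [i0 lt_i0j c0] : exists2 i0 : 'I_m, (i0 < j)%N & c j i0 != 0.
  have [/existsP[i /andP[]]|/existsPn c0] :=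
    boolP [exists i : 'I_m, (i < j)%N && (c j i != 0)]; first by exists i.
  case/eqP: dj; rewrite dx big1 // => i lt_ij.
  by have := c0 i; rewrite lt_ij negbK => /eqP->; rewrite scale0r.
(* The point y has value 1 on a and 0 on b, as i0 < j; on the variables before
   x_j, which d kills, z is constantly equal to y. *)
pose y i := if i == i0 then (c j i0)^-1 else 0.
have [z zP] := integral_curve_exists charK c y.
have z' i : (z i)^`() = feval z (d (fvar K i)).
  rewrite (zP i).1 dx raddf_sum; apply: eq_bigr => l _ /=.
  by rewrite linearZ /= feval_var.
have zy (i : 'I_m) : (i < j)%N -> z i = (y i)%:P.
  move=> lt_ij; rewrite -(zP i).2; apply: (deriv_eq0 charK).
  by rewrite z' d0 ?raddf0.
(* Repeating y above the diagonal gives a and b the upper right entries 1 and 0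
   that the computation of the iterates starts from. *)
pose w i : triangular {poly K} := ((y i)%:P, (y i)%:P, z i).
pose a := d (fvar K j); pose b := fvar K j.
have wa : feval w a = (1, 1, 1).
  rewrite /a dx raddf_sum (bigD1 i0) //= big1 => [|i /andP[lt_ij ne_i]].
    rewrite addr0 linearZ /= feval_var /w zy // /y eqxx.
    by apply: triangularP; rewrite /= -mul_polyC -polyCM divff.
  rewrite linearZ /= feval_var /w zy // /y (negPf ne_i).
  by apply: triangularP; rewrite /= scaler0.
have wb : feval w b = (0, 0, z j).
  by rewrite feval_var /w /y ifN // neq_ltn lt_i0j orbT.
have size_zj : size (z j) = 2.
  have zj' : (z j)^`() = 1.
    have [_] := feval_triangular w a.
    by rewrite wa /= z' => <-.
  apply/anti_leq/andP; split; last first.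
    rewrite ltnNge; apply/negP => /size1_polyC zjC.
    by move/eqP: zj'; rewrite zjC derivC eq_sym oner_eq0.
  apply/leq_sizeP => -[|[|i]] // _.
  have := congr1 (fun q : {poly K} => q`_i.+1) zj'.
  rewrite coef_deriv coef1 /= mulr0n -mulr_natr => /eqP.
  by rewrite mulf_eq0 (negPf (natr_neq0 charK _)) orbF => /eqP.
have da : d a = 0.
  rewrite /a dx; elim/big_rec: _ => [|i g lt_ij IHg]; first exact: derivation0.
  by case: dD => -> _; rewrite d0 // scaler0 add0r.
pose rho (u : relfree W m) := feval w (repr u).
have rhoE f : rho (relfree_proj W f) = feval w f.
  apply/eqP; rewrite -subr_eq0 -raddfB; apply/eqP.
  have /relfree_projP/T_ideal_finP := relfree_reprK (relfree_proj W f).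
  by apply; apply: hMW; apply: triangular_metabelian.
pose B n : {pred relfree W m} := [pred u | bounded n (rho u)].
have B_subalg n : GRing.subalg_closed (B n).
  have [T1 TL TM] := bounded_subalg K n; split=> [|k|].
  - by rewrite inE rhoE rmorph1; apply: T1.
  - elim/relfree_ind=> f; elim/relfree_ind=> g.
    by rewrite !inE -linearP !rhoE linearP; apply: TL.
  - elim/relfree_ind=> f; elim/relfree_ind=> g.
    by rewrite !inE -rmorphM !rhoE rmorphM; apply: TM.
have diag u : u \in constants W d ->
    (size (rho u).1.1 <= 1)%N && (size (rho u).2 <= 1)%N.
  elim/relfree_ind: u => f; rewrite inE (induced_proj charK W dD) rhoE => /eqP df.
  have [-> ->] := feval_triangular w f; apply/andP; split.
    have := feval_closed (v := fun i => (w i).1.1) f (size_le_subalg K).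
    by rewrite inE; apply=> i; rewrite inE size_polyC leq_b1.
  rewrite (deriv_eq0 charK (p := feval _ _)) ?size_polyC ?leq_b1 //.
  rewrite (feval_integral_curve _ dD z').
  have [_ <-] := feval_triangular w (d f).
  by rewrite -rhoE df -(raddf0 (@relfree_proj K W m)) rhoE raddf0.
pose n := \max_(u <- s) size (rho u).1.2.
have sB : {subset s <= B n}.
  move=> u us; have /andP[u1 u2] : (size (rho u).1.1 <= 1)%N && (size (rho u).2 <= 1)%N.
    by apply/diag/sP => C _; apply.
  rewrite inE /bounded u1 u2 andbT /=.
  by apply: (@leq_bigmax_seq _ s xpredT (fun u => size (rho u).1.2)).
pose f := iter n (skew a b) (bracket a b).
have : relfree_proj W f \in B n.
  apply: (sP _).1 (B_subalg n) sB.
  by rewrite inE (induced_proj charK W dD) derivation_iter_skew ?raddf0.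
rewrite inE rhoE /f (rmorph_iter_skew (feval w)) /= wa wb iter_skew_triangular.
rewrite /bounded /= => /and3P[_ + _].
apply/negP; rewrite -ltnNge.
have := size_exp (z j) n.+1; rewrite size_zj mul1n => size_pow.
by apply: leq_trans (leq_pred _); rewrite size_pow.
Qed.
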